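(* Let $p\in(0,1)$, $\rho\in(1,2)\cup(2,+\infty)$ and $y_-<y_+<z_-<z_+$ be such that $z_--y_->z_+-z_-$ and $z_--y_+\ge(\rho-1)^{\frac1{2-\rho}}(z_+-z_-)$. For $x_-,x_+$ with $y_+<x_-<x_+<z_-$, let $\mu=p\,\delta_{x_-}+(1-p)\,\delta_{x_+}$, $$\overline\nu=p\frac{z_+-x_-}{z_+-y_-}\delta_{y_-}+p\frac{x_--y_-}{z_+-y_-}\delta_{z_+}+(1-p)\frac{z_--x_+}{z_--y_+}\delta_{y_+}+(1-p)\frac{x_+-y_+}{z_--y_+}\delta_{z_-},$$ $$\underline\nu=p\frac{z_--x_-}{z_--y_+}\delta_{y_+}+p\frac{x_--y_+}{z_--y_+}\delta_{z_-}+(1-p)\frac{z_+-x_+}{z_+-y_-}\delta_{y_-}+(1-p)\frac{x_+-y_-}{z_+-y_-}\delta_{z_+},$$ $$\overline\pi^\star=p\left(\frac{z_+-x_-}{z_+-y_-}\delta_{(x_-,y_-)}+\frac{x_--y_-}{z_+-y_-}\delta_{(x_-,z_+)}\right)+(1-p)\left(\frac{z_--x_+}{z_--y_+}\delta_{(x_+,y_+)}+\frac{x_+-y_+}{z_--y_+}\delta_{(x_+,z_-)}\right),$$ $$\underline\pi^\star=p\left(\frac{z_--x_-}{z_--y_+}\delta_{(x_-,y_+)}+\frac{x_--y_+}{z_--y_+}\delta_{(x_-,z_-)}\right)+(1-p)\left(\frac{z_+-x_+}{z_+-y_-}\delta_{(x_+,y_-)}+\frac{x_+-y_-}{z_+-y_-}\delta_{(x_+,z_+)}\right).$$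 For $\rho\in(1,2)$ (resp. $\rho>2$), there exists $x_\rho\in(y_+,z_-)$ such that for all $x_-,x_+$ with $x_\rho<x_-<x_+<z_-$, $\overline\pi^\star$ is the unique optimal coupling that attains $\overline{\mathcal M}_\rho(\mu,\overline\nu)$ (resp. $\underline{\mathcal M}_\rho(\mu,\overline\nu)$) and $\underline\pi^\star$ is the unique optimal coupling that attains $\underline{\mathcal M}_\rho(\mu,\underline\nu)$ (resp. $\overline{\mathcal M}_\rho(\mu,\underline\nu)$).
   Context: $\Pi(\mu,\nu)$ is the set of probability measures on $\mathbb R\times\mathbb R$ with first marginal $\mu$ and second marginal $\nu$; $\Pi_M(\mu,\nu)$ is the set of martingale couplings, i.e. of $\pi(dx,dy)=\mu(dx)\pi_x(dy)\in\Pi(\mu,\nu)$ such that $\int_{\mathbb R} y\,\pi_x(dy)=x$ for $\mu(dx)$-almost every $x$. For $\rho>0$, $\overline{\mathcal M}_\rho^\rho(\mu,\nu)$ and $\underline{\mathcal M}_\rho^\rho(\mu,\nu)$ denote respectively the supremum and the infimum of $\int_{\mathbb R\times\mathbb R}|x-y|^\rho\,\pi(dx,dy)$ over $\pi\in\Pi_M(\mu,\nu)$; a coupling in $\Pi_M(\mu,\nu)$ attains $\overline{\mathcal M}_\rho(\mu,\nu)$ (resp. $\underline{\mathcal M}_\rho(\mu,\nu)$) if it attains this supremum (resp. infimum). *)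

(* Defs.v *)
From HB Require Import structures.
From mathcomp Require Import all_boot all_order all_algebra.
From mathcomp Require Import all_classical all_reals all_analysis.
Set Implicit Arguments.
Unset Strict Implicit.
Unset Printing Implicit Defensive.
Import Order.TTheory GRing.Theory Num.Theory.
Import numFieldNormedType.Exports.
Local Open Scope classical_set_scope.
Local Open Scope ring_scope.
Local Open Scope ereal_scope.

(* The measure \sum_(wa <- s) wa.1 * \d_wa.2 given by a list of (weight, atom)
   pairs.  A library measure only takes nonnegative weights, so each weight is
   truncated at 0 to keep the definition total; [atomicE] shows that this has
   no effect on nonnegative weights. *)
Fact truncate_ge0 (R : realType) (w : R) : (0 <= Num.max w 0)%R.
Proof. by rewrite le_max lexx orbT. Qed.

Definition atomic (d : measure_display) (T : measurableType d) (R : realType)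
    (s : seq (R * T)) : {measure set T -> \bar R} :=
  foldr (fun wa m =>
      measure_add (mscale (NngNum (truncate_ge0 wa.1)) (dirac wa.2)) m)
    mzero s.

Lemma atomicE (d : measure_display) (T : measurableType d) (R : realType)
    (s : seq (R * T)) (A : set T) :
  all (fun wa => (0 <= wa.1)%R) s ->
  atomic s A = \sum_(wa <- s) (wa.1)%:E * \d_(wa.2) A.
Proof.
elim: s => [|wa s IHs] /=; first by rewrite big_nil.
move=> /andP[w0 s0]; rewrite big_cons -IHs//.
rewrite [LHS]measure_addE; congr (_ + _).
by change ((Num.max wa.1 0)%:E * \d_(wa.2) A = (wa.1)%:E * \d_(wa.2) A); rewrite max_l.
Qed.

(* Library measures are total set functions whose values on non-measurable
   sets are unconstrained, so equality of measures is tested on measurable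
   sets only. *)
Definition same_measure (d : measure_display) (T : measurableType d)
    (R : realType) (m1 m2 : {measure set T -> \bar R}) : Prop :=
  forall A, measurable A -> m1 A = m2 A.

Definition couplings (R : realType) (mu nu : {measure set R -> \bar R}) :
    set {measure set (R * R) -> \bar R} :=
  [set pi | [/\ pi setT = 1,
    forall A, measurable A -> pi (A `*` setT) = mu A &
    forall B, measurable B -> pi (setT `*` B) = nu B]].

(* pi(dx, dy) = mu(dx) k_x(dy) *)
Definition disintegrates (R : realType) (mu : {measure set R -> \bar R})
    (k : R.-pker R ~> R) (pi : {measure set (R * R) -> \bar R}) : Prop :=
  forall A B, measurable A -> measurable B ->
    pi (A `*` B) = \int[mu]_(x in A) k x B.

Definition martingale_couplings (R : realType)
    (mu nu : {measure set R -> \bar R}) :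
    set {measure set (R * R) -> \bar R} :=
  [set pi | couplings mu nu pi /\
    exists k : R.-pker R ~> R, disintegrates mu k pi /\
      {ae mu, forall x, (k x).-integrable setT (fun y => y%:E) /\
                        \int[k x]_y y%:E = x%:E}].

Definition cost (R : realType) (rho : R)
    (pi : {measure set (R * R) -> \bar R}) : \bar R :=
  \int[pi]_z (`|z.1 - z.2| `^ rho)%R%:E.

(* [Msup] and [Minf] are the rho-th powers of the quantities usually denoted
   \overline M_rho and \underline M_rho. *)
Definition Msup (R : realType) (rho : R) (mu nu : {measure set R -> \bar R}) :
    \bar R :=
  ereal_sup [set cost rho pi | pi in martingale_couplings mu nu].

Definition Minf (R : realType) (rho : R) (mu nu : {measure set R -> \bar R}) :
    \bar R :=
  ereal_inf [set cost rho pi | pi in martingale_couplings mu nu].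

Definition attains_Msup (R : realType) (rho : R)
    (mu nu : {measure set R -> \bar R})
    (pi : {measure set (R * R) -> \bar R}) : Prop :=
  martingale_couplings mu nu pi /\ cost rho pi = Msup rho mu nu.

Definition attains_Minf (R : realType) (rho : R)
    (mu nu : {measure set R -> \bar R})
    (pi : {measure set (R * R) -> \bar R}) : Prop :=
  martingale_couplings mu nu pi /\ cost rho pi = Minf rho mu nu.

Definition unique_measure (d : measure_display) (T : measurableType d)
    (R : realType) (P : {measure set T -> \bar R} -> Prop)
    (m : {measure set T -> \bar R}) : Prop :=
  P m /\ forall m', P m' -> same_measure m' m.

Local Close Scope ereal_scope.

Definition mu_ (R : realType) (p xm xp : R) : {measure set R -> \bar R} :=
  atomic [:: (p, xm); (1 - p, xp)].

Definition nu_over (R : realType) (p ym yp zm zp xm xp : R) :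
    {measure set R -> \bar R} :=
  atomic [:: (p * ((zp - xm) / (zp - ym)), ym);
             (p * ((xm - ym) / (zp - ym)), zp);
             ((1 - p) * ((zm - xp) / (zm - yp)), yp);
             ((1 - p) * ((xp - yp) / (zm - yp)), zm)].

Definition nu_under (R : realType) (p ym yp zm zp xm xp : R) :
    {measure set R -> \bar R} :=
  atomic [:: (p * ((zm - xm) / (zm - yp)), yp);
             (p * ((xm - yp) / (zm - yp)), zm);
             ((1 - p) * ((zp - xp) / (zp - ym)), ym);
             ((1 - p) * ((xp - ym) / (zp - ym)), zp)].

Definition pi_over (R : realType) (p ym yp zm zp xm xp : R) :
    {measure set (R * R) -> \bar R} :=
  atomic [:: (p * ((zp - xm) / (zp - ym)), (xm, ym));
             (p * ((xm - ym) / (zp - ym)), (xm, zp));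
             ((1 - p) * ((zm - xp) / (zm - yp)), (xp, yp));
             ((1 - p) * ((xp - yp) / (zm - yp)), (xp, zm))].

Definition pi_under (R : realType) (p ym yp zm zp xm xp : R) :
    {measure set (R * R) -> \bar R} :=
  atomic [:: (p * ((zm - xm) / (zm - yp)), (xm, yp));
             (p * ((xm - yp) / (zm - yp)), (xm, zm));
             ((1 - p) * ((zp - xp) / (zp - ym)), (xp, ym));
             ((1 - p) * ((xp - ym) / (zp - ym)), (xp, zp))].

(* Main.v *)
From HB Require Import structures.
Require Import Defs.
From mathcomp Require Import all_boot all_order all_algebra.
From mathcomp Require Import all_classical all_reals all_analysis.
From mathcomp Require Import measurable_realfun ring lra.
Set Implicit Arguments.
Unset Strict Implicit.
Unset Printing Implicit Defensive.
Import Order.TTheory GRing.Theory Num.Theory.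
Import numFieldNormedType.Exports.
Local Open Scope classical_set_scope.
Local Open Scope ring_scope.

(** Since [mu] has only two atoms, a martingale coupling of [mu] with a measure
    [nu] carried by four points is determined by the masses [a y] that it gives to
    the points [(xm, y)]: the mass of [(xp, y)] is [nu {y} - a y].  Up to a constant
    its cost is the sum of [a y * F y] over the four points, where
    [F y = |xm - y|^rho - |xp - y|^rho].  The constraints [sum a y = p] and
    [sum a y * y = p xm] leave the comparison of costs unchanged when an affine
    function [L] is subtracted from [F].

    The candidate coupling gives to [xm] all the mass of [nu] at two points
    [u1, u2], and to [xp] all the mass at the two others [v1, v2].  Any other
    coupling removes mass from [(xm, u_i)] and adds mass to [(xm, v_i)].  If
    [F > L] at [u1, u2] and [F < L] at [v1, v2] for some affine [L], every such move
    strictly lowers the cost, and the candidate is the unique maximiser; it is the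
    unique minimiser when both inequalities are reversed.  This is [cost_gap] with
    its consequences [pi_over_unique_sup] and [pi_over_unique_inf], which rest on
    the description of all martingale couplings in [coupling_structure] and, for
    the candidate itself, on [glue_martingale].  Exchanging the pairs
    [(ym, zp)] and [(yp, zm)] turns [nu_over] into [nu_under], so the same [L]
    handles both measures.

    It remains to find [L], i.e. to show that the chord of [F] over [[ym, zp]] lies
    strictly above the values of [F] at [yp] and [zm] when [rho < 2], and strictly
    below them when [rho > 2]; [L] is this chord slightly shifted.  By the mean
    value theorem in the variable that runs from [xm] to [xp]
    ([chord_gap_increment]), it suffices to have this for the functions
    [y |-> sign(y - x) |y - x|^(rho - 1)], and by continuity
    ([chord_gap_left_of_zm]) it suffices to have it at [x = zm].  Put [q = rho - 1],
    [A = zm - ym], [B = zm - yp] and [d = zp - zm].  At the point [zm] the condition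
    compares [A^(q - 1)] with [d^(q - 1)], and follows from [d < A].  At the point
    [yp] it says that the slope [(t^q + d^q) / (t + d)] is smaller at [A] than at
    [B] if [q < 1], larger if [q > 1].  This follows from the position of [t^q] with
    respect to its tangent at [B] once [B >= q^(1 / (1 - q)) d]
    ([slope_gap_lt1], [slope_gap_gt1]). *)

(** * Finitely supported measures *)

Local Open Scope ereal_scope.

Lemma set_mem_cons (T : eqType) (x : T) (s : seq T) :
  [set` x :: s] = x |` [set` s].
Proof.
apply/seteqP; split => y /=; rewrite inE; first by move=> /predU1P[->|]; [left|right].
by move=> [->|->]; rewrite ?eqxx ?orbT.
Qed.

Lemma measurable_seq (d : measure_display) (T : measurableType d) (s : seq T) :
  (forall x : T, measurable [set x]) -> measurable [set` s].
Proof.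
move=> m1; elim: s => [|x s IHs]; first by rewrite set_nil.
by rewrite set_mem_cons; exact: measurableU.
Qed.

Section atomic.
Context (d : measure_display) (T : measurableType d) (R : realType).
Implicit Type s : seq (R * T).

Lemma ge0_integral_atomic s (f : T -> \bar R) :
  all (fun wa => 0 <= wa.1)%R s ->
  measurable_fun setT f -> (forall x, 0 <= f x) ->
  \int[atomic s]_x f x = \sum_(wa <- s) wa.1%:E * f wa.2.
Proof.
move=> + mf f0; elim: s => [|wa s IHs] /=.
  by rewrite big_nil integral_measure_zero.
move=> /andP[w0 s0]; rewrite big_cons -IHs//.
rewrite ge0_integral_measure_add// ge0_integral_mscale// integral_dirac//.
by rewrite diracT mul1e /= max_l.
Qed.

Lemma integrable_atomic s (f : T -> R) :
  all (fun wa => 0 <= wa.1)%R s -> measurable_fun setT f ->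
  (atomic s).-integrable setT (EFin \o f).
Proof.
move=> s0 mf; apply/integrableP; split; first exact/measurable_EFinP.
rewrite ge0_integral_atomic//; last first.
  by apply: measurableT_comp => //; exact/measurable_EFinP.
by rewrite (eq_bigr (fun wa => (wa.1 * `|f wa.2|)%:E))// sumEFin ltry.
Qed.

Lemma integral_atomic s (f : T -> R) :
  all (fun wa => 0 <= wa.1)%R s -> measurable_fun setT f ->
  \int[atomic s]_x (f x)%:E = (\sum_(wa <- s) wa.1 * f wa.2)%:E.
Proof.
move=> s0 mf; have mEf : measurable_fun setT (EFin \o f) by exact/measurable_EFinP.
rewrite integralE !ge0_integral_atomic//; last first.
- exact: measurable_funepos.
- exact: measurable_funeneg.
rewrite [X in X - _](eq_bigr (fun wa => (wa.1 * Num.max (f wa.2) 0)%:E))//; last first.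
  by move=> wa _; rewrite funeposE EFinM EFin_max.
rewrite [X in _ - X](eq_bigr (fun wa => (wa.1 * Num.max (- f wa.2) 0)%:E))//; last first.
  by move=> wa _; rewrite funenegE EFinM EFin_max.
rewrite !sumEFin -EFinB -sumrB; congr EFin; apply: eq_bigr => wa _.
rewrite -mulrBr; congr (_ * _)%R.
by case: (leP (f wa.2) 0%R) => h; [rewrite max_l|rewrite max_r]; lra.
Qed.

(** A measure carried by finitely many points is the sum of its point masses;
    this turns the abstract couplings into finite tables of weights. *)
Lemma same_measure_atomic (m : {measure set T -> \bar R}) (s : seq T) :
  (forall x : T, measurable [set x]) -> m setT < +oo -> uniq s ->
  m (~` [set` s]) = 0 ->
  same_measure m (atomic [seq (fine (m [set x]), x) | x <- s]).
Proof.
move=> m1 mfin us ms0 A mA.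
have mS (t : seq T) : measurable [set` t] by exact: measurable_seq.
rewrite atomicE; last by rewrite all_map; apply/allP => x _ /=; rewrite fine_ge0.
have fin B : measurable B -> m B \is a fin_num.
  by move=> mB; rewrite ge0_fin_numE//; apply: le_lt_trans mfin; rewrite le_measure ?inE.
have -> : m A = m (A `&` [set` s]).
  rewrite -[in LHS](setIT A) -(setvU [set` s]) setIUr setUC measureU//; first last.
  - by rewrite setIACA setICr setI0.
  - by apply: measurableI => //; exact: measurableC.
  - exact: measurableI.
  rewrite [X in _ + X](_ : _ = 0) ?adde0//.
  apply/eqP; rewrite -measure_le0 -ms0 le_measure ?inE//.
    by apply: measurableI => //; exact: measurableC.
  exact: measurableC.
rewrite big_map /=.
elim: s us {ms0} => [_|x s IHs /= /andP[xs us]].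
  by rewrite set_nil setI0 measure0 big_nil.
rewrite big_cons set_mem_cons setIUr measureU//; first last.
- rewrite setIACA [X in _ `&` X](_ : _ = set0) ?setI0//.
  by apply/seteqP; split => // y [/= -> ] xs'; rewrite xs' in xs.
- exact: measurableI.
- exact: measurableI.
congr (_ + _); last exact: IHs.
rewrite fineK ?fin// diracE.
have [xA|xA] := boolP (x \in A).
  rewrite mule1; congr (m _); apply/seteqP; split => y /=; first by case.
  by move=> ->; split => //; rewrite -inE.
rewrite mule0 (_ : A `&` [set x] = set0) ?measure0//.
by apply/seteqP; split => // y [Ay /= yx]; move: xA; rewrite -yx notin_setE.
Qed.
End atomic.

Lemma dirac_setX (d1 d2 : measure_display) (T1 : measurableType d1)
    (T2 : measurableType d2) (R : realType) (x : T1) (y : T2) A B :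
  \d_(x, y) (A `*` B) = \d_x A * \d_y B :> \bar R.
Proof.
rewrite !diracE -EFinM -natrM mulnb; congr (_%:R%:E); congr nat_of_bool.
by apply/idP/andP; rewrite !inE.
Qed.

(** * Martingale couplings of a two-point measure *)

Section two_rows.
Context (R : realType) (p xm xp : R).
Hypotheses (hp : (0 < p < 1)%R) (xmp : (xm < xp)%R).
Implicit Type s : seq (R * R).

Let p0 : (0 <= p)%R. Proof. by case/andP: hp => /ltW. Qed.
Let p1 : (0 <= 1 - p)%R. Proof. by case/andP: hp => _; rewrite subr_ge0 => /ltW. Qed.

Lemma mu_atomsE A : measurable A ->
  mu_ p xm xp A = p%:E * \d_xm A + (1 - p)%:E * \d_xp A.
Proof. by move=> mA; rewrite atomicE/= ?p0 ?p1// !big_cons big_nil adde0. Qed.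

Lemma mu_off_atoms : mu_ p xm xp (~` [set xm; xp]) = 0.
Proof.
rewrite mu_atomsE; last by apply: measurableC; exact: measurableU.
by rewrite !diracE !memNset ?mule0 ?adde0//=; apply; [right|left].
Qed.

Lemma integral_mu_atoms A (f : R -> \bar R) : measurable A ->
  measurable_fun setT f -> (forall x, 0 <= f x) ->
  \int[mu_ p xm xp]_(x in A) f x =
  p%:E * (\d_xm A * f xm) + (1 - p)%:E * (\d_xp A * f xp).
Proof.
move=> mA mf f0; rewrite integral_mkcond ge0_integral_atomic/= ?p0 ?p1//.
- rewrite !big_cons big_nil adde0 !patchE !diracE.
  by do 2![case: ifP => _]; rewrite ?mul1e ?mul0e.
- by apply/(measurable_restrictT _ mA); exact: measurable_funTS.
- by move=> x; rewrite patchE; case: ifP.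
Qed.

(** Both [pi_over] and [pi_under] attach to each atom of [mu_] a law whose mean is
    that atom; any such choice of two laws gives a martingale coupling. *)
Section glue.
Variables s1 s2 : seq (R * R).
Hypotheses (s1_ge0 : all (fun wy => 0 <= wy.1)%R s1)
           (s2_ge0 : all (fun wy => 0 <= wy.1)%R s2).
Hypotheses (mass1 : (\sum_(wy <- s1) wy.1 = 1)%R)
           (mass2 : (\sum_(wy <- s2) wy.1 = 1)%R).
Hypotheses (mean1 : (\sum_(wy <- s1) wy.1 * wy.2 = xm)%R)
           (mean2 : (\sum_(wy <- s2) wy.1 * wy.2 = xp)%R).

Let mass_atomic s : all (fun wy => 0 <= wy.1)%R s ->
  (\sum_(wy <- s) wy.1 = 1)%R -> atomic s [set: R] = 1.
Proof.
move=> s0 sT; rewrite atomicE//.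
rewrite (eq_bigr (fun wy => wy.1%:E)) ?sumEFin ?sT// => wy _.
by rewrite diracT mule1.
Qed.

(** The value away from [xm] only matters at [xp]: [mu_] charges nothing else. *)
Definition row_kernel (x : R) : {measure set R -> \bar R} :=
  if x == xm then atomic s1 else atomic s2.

Let measurable_row_kernel U :
  measurable U -> measurable_fun [set: R] (row_kernel ^~ U).
Proof.
move=> mU; rewrite (_ : row_kernel ^~ U =
    fun x => if x == xm then atomic s1 U else atomic s2 U); last first.
  by apply/funext => x; rewrite /row_kernel; case: ifP.
apply: measurable_fun_if => //.
by apply: measurable_fun_eqr => //; exact: measurable_cst.
Qed.

Let row_kernelT x : row_kernel x [set: R] = 1.
Proof. by rewrite /row_kernel; case: ifP => _; exact: mass_atomic. Qed.

HB.instance Definition _ :=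
  isKernel.Build _ _ R R R row_kernel measurable_row_kernel.
HB.instance Definition _ :=
  Kernel_isProbability.Build _ _ R R R row_kernel row_kernelT.

Definition glue_marginal :=
  [seq (p * wy.1, wy.2)%R | wy <- s1] ++ [seq ((1 - p) * wy.1, wy.2)%R | wy <- s2].
Definition glue :=
  [seq (p * wy.1, (xm, wy.2))%R | wy <- s1] ++
  [seq ((1 - p) * wy.1, (xp, wy.2))%R | wy <- s2].

Lemma glue_ge0 : all (fun wz => 0 <= wz.1)%R glue.
Proof.
rewrite all_cat !all_map; apply/andP; split; apply/allP => wy /=.
  by move=> /(allP s1_ge0) w0; rewrite mulr_ge0.
by move=> /(allP s2_ge0) w0; rewrite mulr_ge0.
Qed.

Lemma glue_marginal_ge0 : all (fun wz => 0 <= wz.1)%R glue_marginal.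
Proof.
rewrite all_cat !all_map; apply/andP; split; apply/allP => wy /=.
  by move=> /(allP s1_ge0) w0; rewrite mulr_ge0.
by move=> /(allP s2_ge0) w0; rewrite mulr_ge0.
Qed.

(* The common shape of the values of [glue] on rectangles, where [e] is the value
   of the first marginal, and of its second marginal, where [e = 1]. *)
Let sum_scaled (c : R) (s : seq (R * R)) (e : \bar R) B :
  all (fun wy => 0 <= wy.1)%R s ->
  \sum_(wy <- s) (c * wy.1)%:E * (e * \d_(wy.2) B) =
  c%:E * (e * \sum_(wy <- s) wy.1%:E * \d_(wy.2) B).
Proof.
move=> s0; rewrite muleA big_seq [in RHS]big_seq ge0_sume_distrr; last first.
  by move=> wy /(allP s0) w0; rewrite mule_ge0 ?lee_fin.
by apply: eq_bigr => wy _; rewrite EFinM muleACA.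
Qed.

Lemma glue_setX A B : measurable A -> measurable B ->
  atomic glue (A `*` B) =
  p%:E * (\d_xm A * atomic s1 B) + (1 - p)%:E * (\d_xp A * atomic s2 B).
Proof.
move=> mA mB; rewrite !atomicE ?glue_ge0// big_cat !big_map/=.
under eq_bigr do rewrite dirac_setX.
under [X in _ + X]eq_bigr do rewrite dirac_setX.
by rewrite !sum_scaled.
Qed.

Lemma glue_marginalE B : measurable B ->
  atomic glue_marginal B = p%:E * atomic s1 B + (1 - p)%:E * atomic s2 B.
Proof.
move=> mB; rewrite !atomicE ?glue_marginal_ge0// big_cat !big_map/=.
under eq_bigr do rewrite -[\d_ _ _]mul1e.
under [X in _ + X]eq_bigr do rewrite -[\d_ _ _]mul1e.
by rewrite !sum_scaled// !mul1e.
Qed.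

Lemma glue_martingale :
  martingale_couplings (mu_ p xm xp) (atomic glue_marginal) (atomic glue).
Proof.
have mT : measurable [set: R] by [].
split.
  split.
  - rewrite -setXTT glue_setX// !diracT !mass_atomic// !mule1 -EFinD.
    by rewrite addrC subrK.
  - by move=> A mA; rewrite glue_setX// !mass_atomic// !mule1 mu_atomsE.
  - by move=> B mB; rewrite glue_setX// !diracT !mul1e glue_marginalE.
have k1 : row_kernel xm = atomic s1 by rewrite /row_kernel eqxx.
have k2 : row_kernel xp = atomic s2 by rewrite /row_kernel gt_eqF.
exists row_kernel; split.
  move=> A B mA mB.
  rewrite (integral_mu_atoms mA (measurable_kernel row_kernel B mB))//.
  by rewrite glue_setX//= k1 k2.
exists (~` [set xm; xp]); split.
- by apply: measurableC; exact: measurableU.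
- exact: mu_off_atoms.
- move=> x /=; apply: contra_not => hx.
  have mid : measurable_fun [set: R] (fun y : R => y) by exact: measurable_id.
  case: hx => -> /=; rewrite ?k1 ?k2.
    by split; [exact: integrable_atomic|rewrite integral_atomic// mean1].
  by split; [exact: integrable_atomic|rewrite integral_atomic// mean2].
Qed.

End glue.
End two_rows.

Section structure.
Context (R : realType) (p xm xp : R).
Hypotheses (hp : (0 < p < 1)%R) (xmp : (xm < xp)%R).
Variables (nu : {measure set R -> \bar R}) (ys : seq R).
Hypotheses (ys_uniq : uniq ys) (nu_ys : nu (~` [set` ys]) = 0).

Let measurable_ys : measurable [set` ys].
Proof. exact: measurable_seq. Qed.

Variables (pi : {measure set (R * R) -> \bar R}).
Hypothesis pi_mc : martingale_couplings (mu_ p xm xp) nu pi.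

Let pi_fst A : measurable A -> pi (A `*` setT) = mu_ p xm xp A.
Proof. by case: pi_mc => -[_ h _] _; exact: h. Qed.

Let pi_snd A : measurable A -> pi (setT `*` A) = nu A.
Proof. by case: pi_mc => -[_ _ h] _; exact: h. Qed.

Let pi_null A : measurable A ->
  A `<=` (~` [set xm; xp] `*` setT) `|` (setT `*` ~` [set` ys]) -> pi A = 0.
Proof.
move=> mA sA; apply/eqP; rewrite -measure_le0.
have m1 : measurable (~` [set xm; xp]).
  by apply: measurableC; exact: measurableU.
have m2 : measurable (~` [set` ys]) by exact: measurableC.
apply: (@le_trans _ _ (pi ((~` [set xm; xp] `*` setT) `|` (setT `*` ~` [set` ys])))).
  by rewrite le_measure ?inE//; apply: measurableU; exact: measurableX.
apply: (le_trans (measureU2 _ _ _)); [exact: measurableX|exact: measurableX|].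
by rewrite [X in X + _]pi_fst// [X in _ + X]pi_snd// nu_ys mu_off_atoms// adde0.
Qed.

Let mass x y := fine (pi [set (x, y)]).

Lemma measurable_set1X (z : R * R) : measurable [set z].
Proof.
case: z => x y; rewrite (_ : [set (x, y)] = [set x] `*` [set y]).
  exact: measurableX.
by apply/seteqP; split => -[a b] /= [-> ->].
Qed.

(** The atom [xm] has positive mass, so the kernel at [xm] cannot lie in the
    exceptional null set: it is a genuine law of mean [xm] and, up to the factor
    [p], the restriction of [pi] to the line over [xm]. *)
Lemma row_disintegration :
  exists m : {measure set R -> \bar R}, [/\ m setT = 1,
    forall B, measurable B -> pi ([set xm] `*` B) = p%:E * m B,
    m.-integrable setT (fun y => y%:E) & \int[m]_y y%:E = xm%:E].
Proof.
have [p0 p1] := andP hp.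
have [_ [k [hk [N [mN N0 hN]]]]] := pi_mc.
exists (k xm).
have [kint kmean] : (k xm).-integrable setT (fun y => y%:E) /\ \int[k xm]_y y%:E = xm%:E.
  apply: contrapT => /hN xmN.
  move: N0; rewrite mu_atomsE// diracE mem_set// mule1 => /eqP; apply/negP.
  rewrite padde_eq0 ?mule_ge0 ?lee_fin ?subr_ge0 ?(ltW p0) ?(ltW p1)//.
  by rewrite eqe gt_eqF.
split => //; first exact: prob_kernel.
move=> B mB; rewrite hk// integral_mu_atoms//; last exact: measurable_kernel.
rewrite diracE mem_set// mul1e diracE memNset ?mul0e ?mule0 ?adde0//=.
by move=> /eqP; rewrite gt_eqF.
Qed.

(** A martingale coupling is a table with two rows of nonnegative masses.  The
    martingale condition need only be recorded for the first row, since [nu]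
    determines the second one. *)
Lemma coupling_structure : exists a b : R -> R,
  [/\ (forall y, 0 <= a y)%R /\ (forall y, 0 <= b y)%R,
      (\sum_(y <- ys) a y = p)%R,
      (\sum_(y <- ys) a y * y = p * xm)%R,
      forall y, nu [set y] = (a y + b y)%:E &
      same_measure pi (atomic ([seq (a y, (xm, y)) | y <- ys] ++
                               [seq (b y, (xp, y)) | y <- ys]))].
Proof.
have [p0 p1] := andP hp.
have pi1 : pi setT = 1 by case: pi_mc => -[].
have fin A : measurable A -> pi A \is a fin_num.
  move=> mA; rewrite ge0_fin_numE//; apply: (@le_lt_trans _ _ (pi setT)).
    by rewrite le_measure ?inE.
  by rewrite pi1 ltry.
exists (mass xm), (mass xp).
have rowE y : pi ([set xm] `*` [set y]) = (mass xm y)%:E.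
  rewrite /mass fineK ?fin//; last exact: measurable_set1X.
  by congr (pi _); apply/seteqP; split => -[a b] /= [-> ->].
have rowE' y : pi ([set xp] `*` [set y]) = (mass xp y)%:E.
  rewrite /mass fineK ?fin//; last exact: measurable_set1X.
  by congr (pi _); apply/seteqP; split => -[a b] /= [-> ->].
have [m [m1 mE mint mmean]] := row_disintegration.
have m_at : same_measure m (atomic [seq (fine (m [set y]), y) | y <- ys]).
  apply: same_measure_atomic => //; first by rewrite m1 ltry.
  apply/eqP; have : p%:E * m (~` [set` ys]) == 0.
    rewrite -mE; last exact: measurableC.
    rewrite pi_null//; last by move=> -[x y] /= [_ ?]; right.
    by apply: measurableX => //; exact: measurableC.
  by rewrite mule_eq0 eqe gt_eqF.
have rowm y : mass xm y = (p * fine (m [set y]))%R.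
  by rewrite -[LHS]/(fine (mass xm y)%:E) -rowE mE// fineM// ge0_fin_numE//;
     apply: le_lt_trans (ltry 1); rewrite -m1 le_measure ?inE.
have m_ge0 : all (fun wy => 0 <= wy.1)%R [seq (fine (m [set y]), y) | y <- ys].
  by rewrite all_map; apply/allP => y _ /=; rewrite fine_ge0.
split.
- by split => y; rewrite fine_ge0.
- rewrite (eq_bigr (fun y => p * fine (m [set y])))%R => [|y _]; last exact: rowm.
  rewrite -mulr_sumr [X in (_ * X)%R](_ : _ = 1%R) ?mulr1//.
  apply: EFin_inj; rewrite -m1 m_at// atomicE// big_map/= -sumEFin.
  by apply: eq_bigr => y _; rewrite diracT mule1.
- rewrite (eq_bigr (fun y => p * (fine (m [set y]) * y)))%R => [|y _]; last first.
    by rewrite rowm mulrA.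
  rewrite -mulr_sumr; congr (_ * _)%R; apply: EFin_inj.
  rewrite -mmean (eq_measure_integral (atomic [seq (fine (m [set y]), y) | y <- ys])).
    by rewrite (integral_atomic (f := id))// big_map.
  by move=> A mA _; exact: m_at.
- move=> y; rewrite -pi_snd// EFinD -rowE -rowE'.
  have mx (x : R) : measurable ([set x] `*` [set y]) by exact: measurableX.
  have mC : measurable (~` [set xm; xp] `*` [set y]).
    by apply: measurableX => //; apply: measurableC; exact: measurableU.
  rewrite -measureU//; last first.
    apply/seteqP; split => // -[u v] /= [[-> _] [/eqP]].
    by rewrite lt_eqF.
  rewrite (_ : setT `*` [set y] = ([set xm] `*` [set y] `|` [set xp] `*` [set y])
     `|` ~` [set xm; xp] `*` [set y]); last first.
    apply/seteqP; split => -[u v] /=; last by move=> [[[_ ->]|[_ ->]]|[_ ->]].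
    move=> [_ ->].
    have [->|ux] := eqVneq u xm; first by left; left.
    have [->|ux'] := eqVneq u xp; first by left; right.
    by right; split => // -[] /eqP; apply/negP.
  rewrite [LHS]measureU//; first last.
  + by apply/seteqP; split => // -[u v] /= [[[-> _]|[-> _]] [hn _]];
      apply: hn; [left|right].
  + exact: measurableU.
  rewrite [X in _ + X]pi_null ?adde0//.
  by move=> -[u v] /= [? _]; left.
- pose pts := [seq (xm, y) | y <- ys] ++ [seq (xp, y) | y <- ys].
  have := @same_measure_atomic _ _ _ pi pts measurable_set1X.
  rewrite map_cat -!map_comp; apply.
  + by rewrite pi1 ltry.
  + rewrite cat_uniq !map_inj_uniq ?ys_uniq/= ?andbT.
    apply/hasPn => z /mapP[y _ ->]; apply/mapP => -[y' _ [/eqP]].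
    by rewrite gt_eqF.
    by move=> u v [].
    by move=> u v [].
  + apply: pi_null.
      by apply: measurableC; apply: measurable_seq; exact: measurable_set1X.
    move=> [u v] /= h.
    have [uE|ux] := eqVneq u xm.
      by right; split => // vy; apply: h; rewrite mem_cat uE (map_f (pair xm)).
    have [uE|ux'] := eqVneq u xp.
      by right; split => // vy; apply: h; rewrite mem_cat uE (map_f (pair xp)) ?orbT.
    by left; split => // -[] /eqP; apply/negP.
Qed.

End structure.

Local Close Scope ereal_scope.

(** * Powers with a real exponent *)

Lemma lt0_gtr_powR (R : realType) (r x y : R) :
  r < 0 -> 0 < x -> x < y -> y `^ r < x `^ r.
Proof.
move=> r0 x0 xy; have y0 := lt_trans x0 xy.
rewrite -[r]opprK !(powRN _ (- r)) ltf_pV2 ?posrE ?powR_gt0//.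
by apply: gt0_ltr_powR; rewrite ?oppr_gt0// nnegrE ltW.
Qed.

Lemma powR_succ (R : realType) (r x : R) : 0 < x -> x `^ r = x * x `^ (r - 1).
Proof.
move=> x0; have xN0 : (1 + (r - 1) == 0) ==> (x != 0) by rewrite (gt_eqF x0) implybT.
by rewrite -[X in X * _](powRr1 (ltW x0)) -powRD// addrC subrK.
Qed.

Lemma derivable_continuous_itv (R : realType) (f df : R -> R) (a b : R) :
  (forall x, a <= x <= b -> is_derive x 1 f (df x)) ->
  {within `[a, b], continuous f}.
Proof.
move=> h; apply: derivable_within_continuous => x.
by rewrite in_itv/= => /h[].
Qed.

(** Source of the two tangent inequalities below: [c^(q - 1)] is compared with
    [b^(q - 1)] by monotonicity, in a direction that depends on the sign of
    [q - 1]. *)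
Lemma powR_secant (R : realType) (q a b : R) : 0 < b -> b < a ->
  exists2 c, b < c < a & a `^ q - b `^ q = q * c `^ (q - 1) * (a - b).
Proof.
move=> b0 ba.
have dq x : b <= x <= a -> is_derive x 1 (@powR R ^~ q) (q * x `^ (q - 1)).
  by move=> /andP[bx _]; apply: is_derive1_powR; exact: lt_le_trans bx.
have dqo x : x \in `]b, a[ -> is_derive x 1 (@powR R ^~ q) (q * x `^ (q - 1)).
  by rewrite in_itv/= => /andP[/ltW bx /ltW xa]; apply: dq; rewrite bx xa.
have [c ci ->] := MVT ba dqo (derivable_continuous_itv dq).
by exists c; [move: ci; rewrite in_itv|].
Qed.

Lemma powR_tangent_lt1 (R : realType) (q a b : R) :
  0 < q < 1 -> 0 < b -> b < a ->
  a `^ q <= b `^ q + q * b `^ (q - 1) * (a - b).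
Proof.
move=> /andP[q0 q1] b0 ba.
have [c /andP[bc ca] E] := powR_secant q b0 ba.
rewrite -lerBlDl E ler_pM2r ?subr_gt0// ler_pM2l//.
by apply/ltW/lt0_gtr_powR; rewrite ?subr_lt0.
Qed.

Lemma powR_tangent_gt1 (R : realType) (q a b : R) :
  1 < q -> 0 < b -> b < a ->
  b `^ q + q * b `^ (q - 1) * (a - b) <= a `^ q.
Proof.
move=> q1 b0 ba; have q0 := lt_trans ltr01 q1.
have [c /andP[bc ca] E] := powR_secant q b0 ba.
rewrite -lerBrDl E ler_pM2r ?subr_gt0// ler_pM2l//.
by apply/ltW/gt0_ltr_powR; rewrite ?subr_gt0 ?nnegrE// ltW// (lt_trans b0).
Qed.

(** [t = q^(1 / (1 - q)) d] is where the tangent to [t^q] has slope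
    [d^(q - 1)], the slope of the segment joining [0] to [(d, d^q)]. *)
Lemma threshold_powR (R : realType) (q d : R) : 0 < q -> q != 1 -> 0 < d ->
  q * (q `^ (1 / (1 - q)) * d) `^ (q - 1) = d `^ (q - 1).
Proof.
move=> q0 q1 d0; rewrite powRM ?powR_ge0 ?(ltW d0)// -powRrM mulrA.
rewrite (_ : 1 / (1 - q) * (q - 1) = -1); last first.
  by field; rewrite subr_eq0 eq_sym.
by rewrite powR_inv1 ?(ltW q0)// divff ?mul1r// gt_eqF.
Qed.


(** The slope [(t^q + d^q) / (t + d)] of the segment from [(- t, - t^q)] to
    [(d, d^q)] is strictly smaller at [t = A] than at [t = B].  Indeed [t^q] stays
    below its tangent at [B], and that tangent is less steep than the segment
    issued from [(- B, - B^q)]: the latter has slope [(B^q + d^q) / (B + d)], while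
    [q B^q < B^q] and, beyond the threshold, [q B^(q - 1) <= d^(q - 1)]. *)
Lemma slope_gap_lt1 (R : realType) (q d B A : R) : 0 < q < 1 -> 0 < d ->
  0 < B -> q `^ (1 / (1 - q)) * d <= B -> B < A ->
  0 < (B `^ q + d `^ q) * (A + d) - (A `^ q + d `^ q) * (B + d).
Proof.
move=> q01 d0 B0 hB BA; have /andP[q0 q1] := q01.
have qB : q * B `^ (q - 1) <= d `^ (q - 1).
  rewrite -(threshold_powR q0 (negbT (lt_eqF q1)) d0) ler_pM2l//.
  move: hB; rewrite le_eqVlt => /predU1P[->//|hB].
  by apply/ltW/lt0_gtr_powR; rewrite ?subr_lt0// mulr_gt0// powR_gt0.
have := powR_tangent_lt1 q01 B0 BA.
have QB : 0 < B `^ (q - 1) by exact: powR_gt0.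
rewrite (powR_succ q B0) (powR_succ q d0).
move: (A `^ q) (B `^ (q - 1)) (d `^ (q - 1)) QB qB => a Q D QB qB aB.
have : 0 < (A - B) * ((1 - q) * (B * Q) + d * (D - q * Q)).
  rewrite mulr_gt0 ?subr_gt0// ltr_pwDl// ?mulr_gt0 ?subr_gt0//.
  by rewrite mulr_ge0 ?subr_ge0 ?(ltW d0).
have : a * (B + d) <= (B * Q + q * Q * (A - B)) * (B + d).
  by rewrite ler_pM2r ?addr_gt0.
lra.
Qed.

(** All the inequalities of [slope_gap_lt1] are reversed when [q > 1]. *)
Lemma slope_gap_gt1 (R : realType) (q d B A : R) : 1 < q -> 0 < d ->
  0 < B -> q `^ (1 / (1 - q)) * d <= B -> B < A ->
  0 < - ((B `^ q + d `^ q) * (A + d) - (A `^ q + d `^ q) * (B + d)).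
Proof.
move=> q1 d0 B0 hB BA; have q0 := lt_trans ltr01 q1.
have qB : d `^ (q - 1) <= q * B `^ (q - 1).
  rewrite -(threshold_powR q0 (negbT (gt_eqF q1)) d0) ler_pM2l//.
  apply: ge0_ler_powR; rewrite ?subr_ge0 ?nnegrE ?(ltW q1) ?(ltW B0)//.
  by rewrite mulr_ge0 ?powR_ge0 ?ltW.
have := powR_tangent_gt1 q1 B0 BA.
have QB : 0 < B `^ (q - 1) by exact: powR_gt0.
rewrite (powR_succ q B0) (powR_succ q d0).
move: (A `^ q) (B `^ (q - 1)) (d `^ (q - 1)) QB qB => a Q D QB qB aB.
have : 0 < (A - B) * ((q - 1) * (B * Q) + d * (q * Q - D)).
  rewrite mulr_gt0 ?subr_gt0// ltr_pwDl// ?mulr_gt0 ?subr_gt0//.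
  by rewrite mulr_ge0 ?subr_ge0 ?(ltW d0).
have : (B * Q + q * Q * (A - B)) * (B + d) <= a * (B + d).
  by rewrite ler_pM2r ?addr_gt0.
lra.
Qed.

Lemma is_derive_powR_subl (R : realType) (r a x : R) : a < x ->
  is_derive x 1 (fun x => (x - a) `^ r) (r * (x - a) `^ (r - 1)).
Proof.
move=> ax.
have h1 : is_derive (x - a) 1 (@powR R ^~ r) (r * (x - a) `^ (r - 1)).
  by apply: is_derive1_powR; rewrite subr_gt0.
have := @is_derive1_comp R (@powR R ^~ r) (fun x => x - a) x _ _ h1.
move=> /(_ 1); rewrite mulr1; apply.
by apply: is_derive_eq; rewrite subr0.
Qed.

Lemma is_derive_powR_subr (R : realType) (r a x : R) : x < a ->
  is_derive x 1 (fun x => (a - x) `^ r) (- (r * (a - x) `^ (r - 1))).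
Proof.
move=> ax.
have h1 : is_derive (a - x) 1 (@powR R ^~ r) (r * (a - x) `^ (r - 1)).
  by apply: is_derive1_powR; rewrite subr_gt0.
have := @is_derive1_comp R (@powR R ^~ r) (fun x => a - x) x _ _ h1.
move=> /(_ (- 1)); rewrite mulrN1; apply.
by apply: is_derive_eq; rewrite add0r mul1r.
Qed.

(** The limit at a zero of the base, where the power need not be
    differentiable. *)
Lemma cvg_powR_subr_left (R : realType) (q z : R) : 0 < q ->
  (z - x) `^ q @[x --> z^'-] --> 0.
Proof.
move=> q0; apply/cvgrPdist_lt => e e0; near=> x.
have xz : 0 < z - x by rewrite subr_gt0.
rewrite sub0r normrN ger0_norm ?powR_ge0//.
rewrite -[ltRHS](powRr1 (ltW e0)) -(mulVf (lt0r_neq0 q0)) powRrM.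
apply: gt0_ltr_powR; rewrite ?nnegrE ?powR_ge0 ?(ltW xz)//.
rewrite ltrBlDr -ltrBlDl; near: x; apply: nbhs_left_gt.
by rewrite ltrBlDr ltrDl powR_gt0.
Unshelve. all: end_near. Qed.

Lemma cvg_left_powR_subl (R : realType) (q a z : R) : a < z ->
  (x - a) `^ q @[x --> z^'-] --> (z - a) `^ q.
Proof.
move=> az; apply: cvg_at_left_filter.
have [d _] := is_derive_powR_subl q az.
by move: d => /derivable1_diffP/differentiable_continuous.
Qed.

Lemma cvg_left_powR_subr (R : realType) (q a z : R) : z < a ->
  (a - x) `^ q @[x --> z^'-] --> (a - z) `^ q.
Proof.
move=> az; apply: cvg_at_left_filter.
have [d _] := is_derive_powR_subr q az.
by move: d => /derivable1_diffP/differentiable_continuous.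
Qed.

(** * The affine function separating the inner from the outer points *)

Section chord.
Variables (R : realType) (ym yp zm zp : R).
Hypotheses (hy : ym < yp) (hyz : yp < zm) (hz : zm < zp).

(** Positive multiple of the height at [y] of the chord through [(ym, f1)] and
    [(zp, f4)] above the value [f]. *)
Definition chord_gap (y f1 f4 f : R) :=
  (zp - y) * f1 + (y - ym) * f4 - (zp - ym) * f.

(** The chord gaps of [sign(. - x) |. - x|^q] at [yp] and [zm] depend
    continuously on [x], so their signs at [x = zm] persist to the left of [zm]. *)
Lemma chord_gap_left_of_zm (q s : R) : 0 < q ->
  0 < s * chord_gap yp (- (zm - ym) `^ q) ((zp - zm) `^ q) (- (zm - yp) `^ q) ->
  0 < s * chord_gap zm (- (zm - ym) `^ q) ((zp - zm) `^ q) 0 ->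
  exists x0, yp < x0 < zm /\ forall x, x0 < x < zm ->
    0 < s * chord_gap yp (- (x - ym) `^ q) ((zp - x) `^ q) (- (x - yp) `^ q) /\
    0 < s * chord_gap zm (- (x - ym) `^ q) ((zp - x) `^ q) ((zm - x) `^ q).
Proof.
move=> q0 g2 g3.
have c1 := @cvg_left_powR_subl R q _ _ (lt_trans hy hyz).
have c2 := @cvg_left_powR_subl R q _ _ hyz.
have c3 := cvg_powR_subr_left zm q0.
have c4 := @cvg_left_powR_subr R q _ _ hz.
have n2 : \forall x \near zm^'-, 0 < s *
    chord_gap yp (- (x - ym) `^ q) ((zp - x) `^ q) (- (x - yp) `^ q).
  exact: (cvgr_gt _ (cvgMl_tmp (cvgB (cvgD (cvgMl_tmp (cvgN c1)) (cvgMl_tmp c4))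
    (cvgMl_tmp (cvgN c2)))) _ g2).
have n3 : \forall x \near zm^'-, 0 < s *
    chord_gap zm (- (x - ym) `^ q) ((zp - x) `^ q) ((zm - x) `^ q).
  exact: (cvgr_gt _ (cvgMl_tmp (cvgB (cvgD (cvgMl_tmp (cvgN c1)) (cvgMl_tmp c4))
    (cvgMl_tmp c3))) _ g3).
have [e /= e0 he] := (nbhs_ballP _ _).1 (filterI n2 n3).
have [m1 m2] := midf_lt hyz.
exists (Num.max (zm - e) ((yp + zm) / 2)); split.
  by rewrite lt_max gt_max m1 m2 orbT ltrBlDr ltrDl e0.
move=> x /andP[]; rewrite gt_max => /andP[x1 _] x2; apply: he => //.
by rewrite /ball/= gtr0_norm ?subr_gt0// ltrBlDr -ltrBlDl.
Qed.

(** The chord gap at [y] of [|a - .|^rho - |b - .|^rho] is the difference of the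
    values at [a] and [b] of a function of [x] whose derivative is [- rho] times
    the chord gap at [y] of [sign(. - x) |. - x|^(rho - 1)].  The functions [w]
    and [dw] stand for [|x - y|^rho] and [- sign(y - x) |x - y|^(rho - 1)]. *)
Lemma chord_gap_increment (rho s a b y : R) (w dw : R -> R) :
  0 < rho -> ym < a -> a < b -> b < zp ->
  (forall x, a <= x <= b -> is_derive x 1 w (rho * dw x)) ->
  (forall x, a < x < b ->
    0 < s * chord_gap y (- (x - ym) `^ (rho - 1)) ((zp - x) `^ (rho - 1)) (- dw x)) ->
  0 < s * chord_gap y ((a - ym) `^ rho - (b - ym) `^ rho)
    ((zp - a) `^ rho - (zp - b) `^ rho) (w a - w b).
Proof.
move=> rho0 ya ab bz w' gap.
pose f x := s * chord_gap y ((x - ym) `^ rho) ((zp - x) `^ rho) (w x).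
pose df x := - (rho * (s * chord_gap y (- (x - ym) `^ (rho - 1))
   ((zp - x) `^ (rho - 1)) (- dw x))).
have f' x : a <= x <= b -> is_derive x 1 f (df x).
  move=> hx; have wx := w' x hx; have /andP[ax xb] := hx.
  have d1 := is_derive_powR_subl rho (lt_le_trans ya ax).
  have d2 := is_derive_powR_subr rho (le_lt_trans xb bz).
  by rewrite /f /df /chord_gap; apply: is_derive_eq; rewrite /GRing.scale/=; ring.
have f'o x : x \in `]a, b[ -> is_derive x 1 f (df x).
  by rewrite in_itv/= => /andP[/ltW ? /ltW ?]; apply/f'/andP.
have [c] := MVT ab f'o (derivable_continuous_itv f').
rewrite in_itv/= => /gap gc fE.
have -> : s * chord_gap y ((a - ym) `^ rho - (b - ym) `^ rho)
    ((zp - a) `^ rho - (zp - b) `^ rho) (w a - w b) = - (f b - f a).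
  by rewrite /f /chord_gap; ring.
by rewrite fE oppr_gt0 pmulr_llt0 ?subr_gt0// oppr_lt0 mulr_gt0.
Qed.

(** Lowering the chord by a small amount (raising it when [s = -1]) makes the
    separation strict at its two endpoints as well. *)
Lemma affine_separation (s f1 f2 f3 f4 : R) : s * s = 1 ->
  0 < s * chord_gap yp f1 f4 f2 -> 0 < s * chord_gap zm f1 f4 f3 ->
  exists al be,
    [/\ 0 < s * (f1 - (al + be * ym)), 0 < s * (f4 - (al + be * zp)),
        s * (f2 - (al + be * yp)) < 0 & s * (f3 - (al + be * zm)) < 0].
Proof.
move=> ss g2 g3; have l0 : 0 < zp - ym by rewrite subr_gt0 (lt_trans hy) ?(lt_trans hyz).
have lN0 := lt0r_neq0 l0.
pose m := Num.min (s * chord_gap yp f1 f4 f2) (s * chord_gap zm f1 f4 f3).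
(* Half of the smaller height of the chord above the two inner values, so that
   the shifted chord still clears them. *)
pose eps := m / 2 / (zp - ym).
have m0 : 0 < m by rewrite lt_min g2 g3.
have eps0 : 0 < eps by rewrite !divr_gt0.
pose be := (f4 - f1) / (zp - ym).
exists (f1 - be * ym - s * eps), be.
have below g f : g = chord_gap yp f1 f4 f2 \/ g = chord_gap zm f1 f4 f3 ->
    s * f = eps - s * g / (zp - ym) -> s * f < 0.
  move=> hg ->; rewrite subr_lt0 /eps ltr_pM2r ?invr_gt0//.
  have : m <= s * g by rewrite /m ge_min; case: hg => ->; rewrite lexx ?orbT.
  by apply: lt_le_trans; rewrite gtr_pMr// invf_lt1// ltr1n.
split.
- have -> : s * (f1 - (f1 - be * ym - s * eps + be * ym)) = s * s * eps by ring.
  by rewrite ss mul1r.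
- have -> : s * (f4 - (f1 - be * ym - s * eps + be * zp)) = s * s * eps.
    by rewrite /be; field.
  by rewrite ss mul1r.
- apply: (below _ _ (or_introl erefl)).
  rewrite -[in RHS](mul1r eps) -ss /be /chord_gap; field.
  exact: lN0.
- apply: (below _ _ (or_intror erefl)).
  rewrite -[in RHS](mul1r eps) -ss /be /chord_gap; field.
  exact: lN0.
Qed.

(** The sign [s] lets the cases [rho < 2] and [rho > 2] share one proof: only the
    sign of the two chord gaps at [zm] distinguishes them. *)
Lemma increments_separated (rho s : R) : 1 < rho -> s * s = 1 ->
  0 < s * chord_gap yp (- (zm - ym) `^ (rho - 1)) ((zp - zm) `^ (rho - 1))
        (- (zm - yp) `^ (rho - 1)) ->
  0 < s * chord_gap zm (- (zm - ym) `^ (rho - 1)) ((zp - zm) `^ (rho - 1)) 0 ->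
  exists xrho, yp < xrho < zm /\ forall xm xp, xrho < xm -> xm < xp -> xp < zm ->
    let F y := `|xm - y| `^ rho - `|xp - y| `^ rho in
    exists al be,
      [/\ 0 < s * (F ym - (al + be * ym)), 0 < s * (F zp - (al + be * zp)),
          s * (F yp - (al + be * yp)) < 0 & s * (F zm - (al + be * zm)) < 0].
Proof.
move=> rho1 ss g2 g3; have q0 : 0 < rho - 1 by rewrite subr_gt0.
have [x0 [/andP[yx0 x0z] h]] := chord_gap_left_of_zm q0 g2 g3.
exists x0; split; first by rewrite yx0 x0z.
move=> a b xa ab bz F.
have ypa := lt_trans yx0 xa.
have ypb := lt_trans ypa ab.
have azm := lt_trans ab bz.
have rho0 := lt_trans ltr01 rho1.
have yma := lt_trans hy ypa.
have bzp := lt_trans bz hz.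
have Fl y : y <= yp -> F y = (a - y) `^ rho - (b - y) `^ rho.
  by move=> yyp; rewrite /F !gtr0_norm// subr_gt0; apply: le_lt_trans yyp _.
have Fr y : zm <= y -> F y = (y - a) `^ rho - (y - b) `^ rho.
  move=> zmy; rewrite /F [`|a - y|]distrC [`|b - y|]distrC.
  by rewrite !gtr0_norm// subr_gt0; apply: lt_le_trans zmy.
have hx x : a < x < b -> x0 < x < zm.
  by move=> /andP[ax xb]; rewrite (lt_trans xa ax) (lt_trans xb bz).
apply: affine_separation => //.
- rewrite (Fl ym) ?(Fl yp) ?(Fr zp) ?(ltW hy) ?(ltW hz)//.
  apply: (chord_gap_increment (w := fun x => (x - yp) `^ rho)
    (dw := fun x => (x - yp) `^ (rho - 1))) => //.
  + by move=> x /andP[ax _]; apply: is_derive_powR_subl; exact: lt_le_trans ax.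
  + by move=> x /hx /h[].
- rewrite (Fl ym) ?(Fr zm) ?(Fr zp) ?(ltW hy) ?(ltW hz)//.
  apply: (chord_gap_increment (w := fun x => (zm - x) `^ rho)
    (dw := fun x => - (zm - x) `^ (rho - 1))) => //.
  + move=> x /andP[_ xb]; rewrite mulrN.
    by apply: is_derive_powR_subr; exact: le_lt_trans bz.
  + by move=> x /hx /h[_]; rewrite opprK.
Qed.

End chord.

Lemma increments_separated_lt2 (R : realType) (rho ym yp zm zp : R) :
  1 < rho < 2 -> ym < yp -> yp < zm -> zm < zp -> zp - zm < zm - ym ->
  (rho - 1) `^ (1 / (2 - rho)) * (zp - zm) <= zm - yp ->
  exists xrho, yp < xrho < zm /\ forall xm xp, xrho < xm -> xm < xp -> xp < zm ->
    let F y := `|xm - y| `^ rho - `|xp - y| `^ rho in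
    exists al be,
      [/\ 0 < F ym - (al + be * ym), 0 < F zp - (al + be * zp),
          F yp - (al + be * yp) < 0 & F zm - (al + be * zm) < 0].
Proof.
move=> /andP[rho1 rho2] hy hyz hz hgap hgap_rho.
have q01 : 0 < rho - 1 < 1 by rewrite subr_gt0 rho1/= ltrBlDr.
have d0 : 0 < zp - zm by rewrite subr_gt0.
have B0 : 0 < zm - yp by rewrite subr_gt0.
have BA : zm - yp < zm - ym by rewrite ltrD2l ltrN2.
have hK : (rho - 1) `^ (1 / (1 - (rho - 1))) * (zp - zm) <= zm - yp.
  by rewrite (_ : 1 - (rho - 1) = 2 - rho)//; ring.
have g2 := slope_gap_lt1 q01 d0 B0 hK BA.
have g3 : 0 < (zm - ym) * (zp - zm) `^ (rho - 1) - (zp - zm) * (zm - ym) `^ (rho - 1).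
  have A0 := lt_trans d0 hgap; rewrite (powR_succ _ A0) (powR_succ _ d0).
  rewrite mulrCA -mulrBr mulr_gt0// -mulrBr mulr_gt0// subr_gt0.
  by apply: lt0_gtr_powR; rewrite // subr_lt0; case/andP: q01.
have [||xrho [hx h]] :=
    @increments_separated R ym yp zm zp hy hyz hz rho 1 rho1 (mulr1 1).
- rewrite mul1r /chord_gap; lra.
- by rewrite mul1r /chord_gap mulr0 subr0 mulrN addrC.
exists xrho; split => // xm xp h1 h2 h3 F.
by have [al [be]] := h _ _ h1 h2 h3; rewrite !mul1r; exists al, be.
Qed.

Lemma increments_separated_gt2 (R : realType) (rho ym yp zm zp : R) :
  2 < rho -> ym < yp -> yp < zm -> zm < zp -> zp - zm < zm - ym ->
  (rho - 1) `^ (1 / (2 - rho)) * (zp - zm) <= zm - yp ->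
  exists xrho, yp < xrho < zm /\ forall xm xp, xrho < xm -> xm < xp -> xp < zm ->
    let F y := `|xm - y| `^ rho - `|xp - y| `^ rho in
    exists al be,
      [/\ F ym - (al + be * ym) < 0, F zp - (al + be * zp) < 0,
          0 < F yp - (al + be * yp) & 0 < F zm - (al + be * zm)].
Proof.
move=> rho2 hy hyz hz hgap hgap_rho.
have q1 : 1 < rho - 1 by rewrite ltrBrDr.
have rho1 : 1 < rho by rewrite (lt_trans _ rho2)// ltr1n.
have d0 : 0 < zp - zm by rewrite subr_gt0.
have B0 : 0 < zm - yp by rewrite subr_gt0.
have BA : zm - yp < zm - ym by rewrite ltrD2l ltrN2.
have hK : (rho - 1) `^ (1 / (1 - (rho - 1))) * (zp - zm) <= zm - yp.
  by rewrite (_ : 1 - (rho - 1) = 2 - rho)//; ring.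
have g2 := slope_gap_gt1 q1 d0 B0 hK BA.
have g3 : 0 < (zp - zm) * (zm - ym) `^ (rho - 1) - (zm - ym) * (zp - zm) `^ (rho - 1).
  have A0 := lt_trans d0 hgap; rewrite (powR_succ _ A0) (powR_succ _ d0).
  rewrite mulrCA -mulrBr mulr_gt0// -mulrBr mulr_gt0// subr_gt0.
  by apply: gt0_ltr_powR; rewrite // ?nnegrE ?ltW// subr_gt0.
have [|||xrho [hx h]] := @increments_separated R ym yp zm zp hy hyz hz rho (- 1) rho1.
- by rewrite mulrNN mulr1.
- rewrite mulN1r /chord_gap; lra.
- by rewrite mulN1r /chord_gap mulr0 subr0 mulrN opprD opprK.
exists xrho; split => // xm xp h1 h2 h3 F.
have [al [be]] := h _ _ h1 h2 h3; rewrite !mulN1r !oppr_gt0 !oppr_lt0.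
by exists al, be.
Qed.

(** * Optimality from a separating affine function *)

Lemma measurable_cost_integrand (R : realType) (rho : R) :
  measurable_fun [set: R * R] (fun z => `|z.1 - z.2| `^ rho).
Proof.
apply: (measurableT_comp (measurable_powR rho)).
apply: (measurableT_comp (@normr_measurable R setT)).
exact: measurable_funB.
Qed.

Lemma cost_atomic (R : realType) (rho : R) (s : seq (R * (R * R))) :
  all (fun wz => 0 <= wz.1) s ->
  cost rho (atomic s) = (\sum_(wz <- s) wz.1 * `|wz.2.1 - wz.2.2| `^ rho)%:E.
Proof. by move=> s0; rewrite /cost integral_atomic//; exact: measurable_cost_integrand. Qed.

Lemma same_measure_cost (R : realType) (rho : R)
    (m1 m2 : {measure set (R * R) -> \bar R}) :
  same_measure m1 m2 -> cost rho m1 = cost rho m2.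
Proof. by move=> h; apply: eq_measure_integral => A mA _; exact: h. Qed.

(** The supports [u1, u2] of the first row and [v1, v2] of the second one are in
    no particular relative position, because [nu_under] and [pi_under] are
    [nu_over] and [pi_over] with the roles of the inner and outer points
    exchanged. *)
Section optimality.
Context (R : realType) (p rho xm xp u1 u2 v1 v2 : R).
Hypotheses (hp : 0 < p < 1) (xmp : xm < xp).
Hypotheses (u1x : u1 < xm) (xu2 : xm < u2) (v1x : v1 < xp) (xv2 : xp < v2).
Hypothesis (uv_uniq : uniq [:: u1; u2; v1; v2]).

Let nu := nu_over p u1 v1 v2 u2 xm xp.
Let pis := pi_over p u1 v1 v2 u2 xm xp.
Let F y := `|xm - y| `^ rho - `|xp - y| `^ rho.

Let u0 : 0 < u2 - u1. Proof. by rewrite subr_gt0 (lt_trans u1x). Qed.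
Let v0 : 0 < v2 - v1. Proof. by rewrite subr_gt0 (lt_trans v1x). Qed.

Let s1 := [:: ((u2 - xm) / (u2 - u1), u1); ((xm - u1) / (u2 - u1), u2)].
Let s2 := [:: ((v2 - xp) / (v2 - v1), v1); ((xp - v1) / (v2 - v1), v2)].

Let s1_ge0 : all (fun wy => 0 <= wy.1) s1.
Proof. by rewrite /= !divr_ge0 ?(ltW u0) ?subr_ge0 ?ltW. Qed.

Let s2_ge0 : all (fun wy => 0 <= wy.1) s2.
Proof. by rewrite /= !divr_ge0 ?(ltW v0) ?subr_ge0 ?ltW. Qed.

Lemma pi_over_martingale : martingale_couplings (mu_ p xm xp) nu pis.
Proof.
have uN0 := lt0r_neq0 u0; have vN0 := lt0r_neq0 v0.
apply: (@glue_martingale R p xm xp hp xmp s1 s2) => //.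
- by rewrite !big_cons big_nil/=; field.
- by rewrite !big_cons big_nil/=; field.
- by rewrite !big_cons big_nil/=; field.
- by rewrite !big_cons big_nil/=; field.
Qed.

Let nu_ge0 : all (fun wy => 0 <= wy.1) (glue_marginal p s1 s2).
Proof. exact: glue_marginal_ge0. Qed.

Let nu_null : nu (~` [set` [:: u1; u2; v1; v2]]) = 0%E.
Proof.
rewrite /nu /nu_over atomicE; last exact: nu_ge0.
rewrite !big_cons big_nil !diracE !memNset ?mule0 ?adde0//=.
all: by move=> h; apply: h; rewrite /= !inE eqxx ?orbT.
Qed.

(** A coupling [pi] differs from [pis] by the masses [bu1], [bu2] that [xp] sends
    to the points reserved for [xm], and [av1], [av2] that [xm] sends to those
    reserved for [xp].  Both rows keep their mass and mean, so the difference of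
    costs only sees [F] modulo affine functions. *)
Lemma cost_gap pi : martingale_couplings (mu_ p xm xp) nu pi ->
  exists c bu1 bu2 av1 av2 : R,
    [/\ cost rho pi = c%:E,
        [/\ 0 <= bu1, 0 <= bu2, 0 <= av1 & 0 <= av2],
        forall al be, let G y := F y - (al + be * y) in
          cost rho pis = (c + (bu1 * G u1 + bu2 * G u2 - av1 * G v1 - av2 * G v2))%:E &
        bu1 = 0 -> bu2 = 0 -> av1 = 0 -> av2 = 0 -> same_measure pi pis].
Proof.
move=> hpi.
have [a [b [[a0 b0] sa say nuab pi_at]]] := coupling_structure hp xmp uv_uniq nu_null hpi.
have uN0 := lt0r_neq0 u0; have vN0 := lt0r_neq0 v0.
have [] : [/\ a u1 + b u1 = p * ((u2 - xm) / (u2 - u1)),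
   a u2 + b u2 = p * ((xm - u1) / (u2 - u1)),
   a v1 + b v1 = (1 - p) * ((v2 - xp) / (v2 - v1)) &
   a v2 + b v2 = (1 - p) * ((xp - v1) / (v2 - v1))].
  move: uv_uniq; rewrite /= !inE !negb_or => /and4P[/and3P[n1 n2 n3] /andP[n4 n5] n6 _].
  have ne (y z : R) : y != z -> (y == z = false) * (z == y = false).
    by move=> /negbTE yz; rewrite [z == y]eq_sym yz.
  have ns := (ne _ _ n1, ne _ _ n2, ne _ _ n3, ne _ _ n4, ne _ _ n5, ne _ _ n6).
  have nu1 y : (a y + b y)%:E = (\sum_(wy <- glue_marginal p s1 s2) wy.1 * (wy.2 == y)%:R)%:E.
    rewrite -nuab /nu /nu_over atomicE; last exact: nu_ge0.
    rewrite -sumEFin; apply: eq_bigr => wy _; rewrite diracE EFinM.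
    congr (_ * (nat_of_bool _)%:R%:E)%E.
    by apply/idP/eqP; rewrite inE.
  split; apply: EFin_inj; rewrite nu1 !big_cons big_nil/= ?eqxx;
    by rewrite !ns !mulr0 !mulr1 ?addr0 ?add0r.
rewrite !big_cons !big_nil !addr0 in sa say.
move=> e1 e2 e3 e4.
pose C (x y : R) : R := `|x - y| `^ rho.
exists (a u1 * C xm u1 + a u2 * C xm u2 + a v1 * C xm v1 + a v2 * C xm v2 +
        (b u1 * C xp u1 + b u2 * C xp u2 + b v1 * C xp v1 + b v2 * C xp v2)).
exists (b u1), (b u2), (a v1), (a v2); split => //.
- rewrite (same_measure_cost rho pi_at) cost_atomic/= ?a0 ?b0//.
  by rewrite !big_cons big_nil/= /C; congr EFin; ring.
- move=> al be G; rewrite /pis /pi_over cost_atomic; last first.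
    exact: (@glue_ge0 R p xm xp hp s1 s2).
  rewrite !big_cons big_nil/= -e1 -e2 -e3 -e4 -!/(C _ _); congr EFin.
  (* The displaced masses have zero total and zero first moment, so the affine
     function cancels. *)
  have m0 : b u1 + b u2 - a v1 - a v2 = 0.
    have : (a u1 + b u1) + (a u2 + b u2) = p by rewrite e1 e2; field.
    by lra.
  have m1 : b u1 * u1 + b u2 * u2 - a v1 * v1 - a v2 * v2 = 0.
    have : (a u1 + b u1) * u1 + (a u2 + b u2) * u2 = p * xm by rewrite e1 e2; field.
    by lra.
  have : al * (b u1 + b u2 - a v1 - a v2) +
         be * (b u1 * u1 + b u2 * u2 - a v1 * v1 - a v2 * v2) = 0.
    by rewrite m0 m1 !mulr0 addr0.
  rewrite /G /F -!/(C _ _); lra.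
- move=> bu1 bu2 av1 av2 B mB; rewrite pi_at//.
  rewrite [LHS]atomicE; last by rewrite /= !a0 !b0.
  rewrite [RHS]atomicE; last exact: (@glue_ge0 R p xm xp hp s1 s2).
  rewrite !big_cons big_nil/= -e1 -e2 -e3 -e4 bu1 bu2 av1 av2.
  by rewrite !(mul0e, addr0, add0r) addeA.
Qed.

(** When an affine function separates [F] on [u1, u2] from [F] on [v1, v2], every
    displaced mass contributes to the difference of costs with the same sign [s],
    strictly unless it vanishes. *)
Lemma signed_cost_gap s al be : s * s = 1 -> let G y := F y - (al + be * y) in
  0 < s * G u1 -> 0 < s * G u2 -> s * G v1 < 0 -> s * G v2 < 0 ->
  forall pi, martingale_couplings (mu_ p xm xp) nu pi ->
  exists c g : R, [/\ cost rho pi = c%:E, cost rho pis = (c + s * g)%:E,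
    0 <= g & g = 0 -> same_measure pi pis].
Proof.
move=> ss G gu1 gu2 gv1 gv2 pi.
move=> /cost_gap[c [b1 [b2 [a1 [a2 [hc [b10 b20 a10 a20] hs hsame]]]]]].
have t1 : 0 <= b1 * (s * G u1) by rewrite mulr_ge0 ?(ltW gu1).
have t2 : 0 <= b2 * (s * G u2) by rewrite mulr_ge0 ?(ltW gu2).
have t3 : 0 <= - (a1 * (s * G v1)) by rewrite oppr_ge0 mulr_ge0_le0 ?(ltW gv1).
have t4 : 0 <= - (a2 * (s * G v2)) by rewrite oppr_ge0 mulr_ge0_le0 ?(ltW gv2).
exists c, (b1 * (s * G u1) + b2 * (s * G u2) - a1 * (s * G v1) - a2 * (s * G v2)).
split => //.
- rewrite (hs al be) -!/(G _); congr (_ + _)%:E.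
  rewrite (_ : s * _ = s * s * (b1 * G u1 + b2 * G u2 - a1 * G v1 - a2 * G v2)).
    by rewrite ss mul1r.
  by ring.
- by rewrite !addr_ge0.
- move=> /eqP; rewrite !paddr_eq0 ?addr_ge0// !oppr_eq0 ![_ * (s * _) == 0]mulf_eq0.
  rewrite (gt_eqF gu1) (gt_eqF gu2) (lt_eqF gv1) (lt_eqF gv2) !orbF.
  by move=> /andP[/andP[/andP[/eqP ? /eqP ?] /eqP ?] /eqP ?]; exact: hsame.
Qed.

Lemma pi_over_unique_sup al be : let G y := F y - (al + be * y) in
  0 < G u1 -> 0 < G u2 -> G v1 < 0 -> G v2 < 0 ->
  unique_measure (attains_Msup rho (mu_ p xm xp) nu) pis.
Proof.
move=> G gu1 gu2 gv1 gv2.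
have gap := @signed_cost_gap 1 al be (mulr1 1).
rewrite /= !mul1r in gap; move: gap => /(_ gu1 gu2 gv1 gv2) gap.
have sup : cost rho pis = Msup rho (mu_ p xm xp) nu.
  apply/eqP; rewrite eq_le ereal_sup_ubound/=; last first.
    by exists pis => //; exact: pi_over_martingale.
  apply: ge_ereal_sup => _ [pi /gap[c [g [-> -> g0 _]]] <-].
  by rewrite mul1r lee_fin lerDl.
split; first by split => //; exact: pi_over_martingale.
move=> pi [/gap[c [g [-> hs _ hsame]]]]; rewrite -sup hs mul1r => -[cE].
by apply: hsame; apply: (addrI c); rewrite addr0 -cE.
Qed.

Lemma pi_over_unique_inf al be : let G y := F y - (al + be * y) in
  G u1 < 0 -> G u2 < 0 -> 0 < G v1 -> 0 < G v2 ->
  unique_measure (attains_Minf rho (mu_ p xm xp) nu) pis.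
Proof.
move=> G gu1 gu2 gv1 gv2.
have NN : -1 * -1 = 1 :> R by rewrite mulrNN mulr1.
have gap := @signed_cost_gap (-1) al be NN.
rewrite /= !mulN1r !oppr_gt0 !oppr_lt0 in gap; move: gap => /(_ gu1 gu2 gv1 gv2) gap.
have inf : cost rho pis = Minf rho (mu_ p xm xp) nu.
  apply/eqP; rewrite eq_le ereal_inf_lbound/= ?andbT; last first.
    by exists pis => //; exact: pi_over_martingale.
  apply: le_ereal_inf_tmp => _ [pi /gap[c [g [-> -> g0 _]]] <-].
  by rewrite mulN1r lee_fin gerBl.
split; first by split => //; exact: pi_over_martingale.
move=> pi [/gap[c [g [-> hs _ hsame]]]]; rewrite -inf hs mulN1r => -[cE].
by apply: hsame; apply: oppr_inj; apply: (addrI c); rewrite oppr0 addr0 -cE.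
Qed.
End optimality.

Theorem proposition2p23 (R : realType) (p rho ym yp zm zp : R)
    (hp : 0 < p < 1)
    (hrho : 1 < rho < 2 \/ 2 < rho)
    (hy : ym < yp) (hyz : yp < zm) (hz : zm < zp)
    (hgap : zp - zm < zm - ym)
    (hgap_rho : (rho - 1) `^ (1 / (2 - rho)) * (zp - zm) <= zm - yp) :
  (1 < rho < 2 ->
   exists xrho : R, yp < xrho < zm /\
     forall xm xp : R, xrho < xm -> xm < xp -> xp < zm ->
       unique_measure
         (attains_Msup rho (mu_ p xm xp) (nu_over p ym yp zm zp xm xp))
         (pi_over p ym yp zm zp xm xp)
       /\
       unique_measure
         (attains_Minf rho (mu_ p xm xp) (nu_under p ym yp zm zp xm xp))
         (pi_under p ym yp zm zp xm xp))
  /\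
  (2 < rho ->
   exists xrho : R, yp < xrho < zm /\
     forall xm xp : R, xrho < xm -> xm < xp -> xp < zm ->
       unique_measure
         (attains_Minf rho (mu_ p xm xp) (nu_over p ym yp zm zp xm xp))
         (pi_over p ym yp zm zp xm xp)
       /\
       unique_measure
         (attains_Msup rho (mu_ p xm xp) (nu_under p ym yp zm zp xm xp))
         (pi_under p ym yp zm zp xm xp)).
Proof.
have hyz' := lt_trans hy hyz; have hyz'' := lt_trans hyz hz.
have ne (y z : R) : y < z -> (y == z = false) * (z == y = false).
  by move=> yz; rewrite lt_eqF ?gt_eqF.
have ns := (ne _ _ hy, ne _ _ hyz, ne _ _ hz, ne _ _ hyz', ne _ _ hyz'',
  ne _ _ (lt_trans hy hyz'')).
have uniq_over : uniq [:: ym; zp; yp; zm] by rewrite /= !inE !ns.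
have uniq_under : uniq [:: yp; zm; ym; zp] by rewrite /= !inE !ns.
have order xrho xm xp : yp < xrho < zm -> xrho < xm -> xm < xp -> xp < zm ->
    [/\ ym < xm /\ ym < xp, yp < xm /\ yp < xp, xm < zm /\ xp < zm & xm < zp /\ xp < zp].
  by move=> /andP[? ?] ? ? ?; split; split; lra.
split=> hr.
  have [xrho [hx hF]] := increments_separated_lt2 hr hy hyz hz hgap hgap_rho.
  exists xrho; split => // xm xp h1 h2 h3.
  have [[? ?] [? ?] [? ?] [? ?]] := order _ _ _ hx h1 h2 h3.
  have [al [be [? ? ? ?]]] := hF _ _ h1 h2 h3.
  split.
    by apply: (@pi_over_unique_sup R p rho xm xp ym zp yp zm hp h2 _ _ _ _ _ al be).
  by apply: (@pi_over_unique_inf R p rho xm xp yp zm ym zp hp h2 _ _ _ _ _ al be).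
have [xrho [hx hF]] := increments_separated_gt2 hr hy hyz hz hgap hgap_rho.
exists xrho; split => // xm xp h1 h2 h3.
have [[? ?] [? ?] [? ?] [? ?]] := order _ _ _ hx h1 h2 h3.
have [al [be [? ? ? ?]]] := hF _ _ h1 h2 h3.
split.
    by apply: (@pi_over_unique_inf R p rho xm xp ym zp yp zm hp h2 _ _ _ _ _ al be).
by apply: (@pi_over_unique_sup R p rho xm xp yp zm ym zp hp h2 _ _ _ _ _ al be).
Qed.
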